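(* For every integer $n$, $$\left(F^{(3)}_{n}\right)^{2}-F^{(3)}_{n-1}\,F^{(3)}_{n+1}=F^{(3)}_{1-n}.$$
   Context: The Tribonacci numbers $(F^{(3)}_n)_{n\in\mathbb{Z}}$ are the bi-infinite integer sequence with $F^{(3)}_0=F^{(3)}_1=0$, $F^{(3)}_2=1$ and $F^{(3)}_n=F^{(3)}_{n-1}+F^{(3)}_{n-2}+F^{(3)}_{n-3}$ for all $n\in\mathbb{Z}$. *)

(* Defs.v *)
From mathcomp Require Import all_boot all_order all_algebra.
From mathcomp Require Import ring.
Set Implicit Arguments.
Unset Strict Implicit.
Unset Printing Implicit Defensive.
Import GRing.Theory.
Local Open Scope ring_scope.

(* A window (F_n, F_{n+1}, F_{n+2}) is shifted to (F_{n+1}, F_{n+2}, F_{n+3}),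
   resp. to (F_{n-1}, F_n, F_{n+1}), by solving the recurrence
   F_{n+3} = F_{n+2} + F_{n+1} + F_n for the missing term. *)
Definition trib_next (w : int * int * int) : int * int * int :=
  let: (a, b, c) := w in (b, c, c + b + a).

Definition trib_prev (w : int * int * int) : int * int * int :=
  let: (a, b, c) := w in (c - b - a, a, b).

Definition trib_window (n : int) : int * int * int :=
  match n with
  | Posz m => iter m trib_next (0, 0, 1)
  | Negz m => iter m.+1 trib_prev (0, 0, 1)
  end.

Definition tribonacci (n : int) : int := (trib_window n).1.1.

Lemma trib_prevK : cancel trib_prev trib_next.
Proof. by case=> [[a b] c] /=; congr (_, _, _); ring. Qed.

Lemma trib_windowS (n : int) : trib_window (n + 1) = trib_next (trib_window n).
Proof.
case: n => [m|[|m]].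
- by rewrite -PoszD addn1.
- exact: esym (trib_prevK _).
- have -> : Negz m.+1 + 1 = Negz m by rewrite !NegzE -[m.+2]addn1 PoszD; ring.
  exact: esym (trib_prevK _).
Qed.

(* The four conditions that define the sequence, and the fact that they
   determine it. *)
Lemma tribonacci0 : tribonacci 0 = 0. Proof. by []. Qed.
Lemma tribonacci1 : tribonacci 1 = 0. Proof. by []. Qed.
Lemma tribonacci2 : tribonacci 2 = 1. Proof. by []. Qed.

Lemma tribonacci_rec (n : int) :
  tribonacci n = tribonacci (n - 1) + tribonacci (n - 2) + tribonacci (n - 3).
Proof.
have -> : n = n - 3 + 1 + 1 + 1 by ring.
have -> : n - 3 + 1 + 1 + 1 - 1 = n - 3 + 1 + 1 by ring.
have -> : n - 3 + 1 + 1 + 1 - 2 = n - 3 + 1 by ring.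
have -> : n - 3 + 1 + 1 + 1 - 3 = n - 3 by ring.
by rewrite /tribonacci !trib_windowS; case: (trib_window (n - 3)) => [[a b] c].
Qed.

Lemma tribonacci_unique (F : int -> int) :
    F 0 = 0 -> F 1 = 0 -> F 2 = 1 ->
    (forall n, F n = F (n - 1) + F (n - 2) + F (n - 3)) ->
  F =1 tribonacci.
Proof.
move=> F0 F1 F2 Frec n.
suff H : (F n, F (n + 1), F (n + 2)) = trib_window n by rewrite /tribonacci -H.
have step m : F (m + 3) = F (m + 2) + F (m + 1) + F m.
  by rewrite Frec; congr (F _ + F _ + F _); ring.
have nextK : cancel trib_next trib_prev.
  by case=> [[a b] c] /=; congr (_, _, _); ring.
have shift m : (F (m + 1), F (m + 1 + 1), F (m + 1 + 2))
             = trib_next (F m, F (m + 1), F (m + 2)).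
  rewrite /= -step; congr (_, F _, F _); ring.
elim/int_rec: n => [|m IH|m IH].
- by rewrite !add0r F0 F1 F2.
- by rewrite -addn1 PoszD shift trib_windowS IH.
- have E : - m.+1%:Z + 1 = - m%:Z by rewrite -addn1 PoszD; ring.
  by apply: (can_inj nextK); rewrite -shift -trib_windowS E.
Qed.

(* Main.v *)
Require Import Defs.
From mathcomp Require Import all_boot all_order all_algebra.
From mathcomp Require Import ring.
Import GRing.Theory.
Local Open Scope ring_scope.

(** Write F n for the Tribonacci numbers and D n for F n ^ 2 - F (n-1) * F (n+1).
    If x, y, z are the roots of X^3 - X^2 - X - 1, then F n is a linear
    combination of x^n, y^n, z^n.  In D n the terms x^(2n), y^(2n), z^(2n)
    cancel, which leaves a combination of (xy)^n, (yz)^n, (zx)^n.  As xyz = 1,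
    these are z^(-n), x^(-n), y^(-n): hence D satisfies the Tribonacci
    recurrence read backwards ([tribonacci_minor_rec]).  The sequence
    n |-> D (1 - n) therefore satisfies the forward recurrence, and it starts
    with 0, 0, 1, so it is the Tribonacci sequence itself
    ([tribonacci_unique]). *)

Definition tribonacci_minor (n : int) : int :=
  tribonacci n ^+ 2 - tribonacci (n - 1) * tribonacci (n + 1).

Lemma tribonacci_step (n : int) :
  tribonacci (n + 3) = tribonacci (n + 2) + tribonacci (n + 1) + tribonacci n.
Proof.
by rewrite tribonacci_rec; congr (tribonacci _ + tribonacci _ + tribonacci _);
  ring.
Qed.

(** Stepping the recurrence forward turns both sides into quadratic forms in
    the three consecutive values F (n-1), F n, F (n+1); these forms are equal,
    so no initial value enters. *)
Lemma tribonacci_minor_rec (n : int) :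
  tribonacci_minor n = tribonacci_minor (n + 1) + tribonacci_minor (n + 2)
                       + tribonacci_minor (n + 3).
Proof.
rewrite /tribonacci_minor.
have -> : n + 1 - 1 = n by ring.
have -> : n + 1 + 1 = n + 2 by ring.
have -> : n + 2 - 1 = n + 1 by ring.
have -> : n + 2 + 1 = n + 3 by ring.
have -> : n + 3 - 1 = n + 2 by ring.
have -> : n + 3 + 1 = n + 1 + 3 by ring.
have F2 : tribonacci (n + 2)
        = tribonacci (n + 1) + tribonacci n + tribonacci (n - 1).
  have -> : n + 2 = n - 1 + 3 by ring.
  by rewrite tribonacci_step; congr (tribonacci _ + tribonacci _ + _); ring.
have F4 : tribonacci (n + 1 + 3)
        = tribonacci (n + 3) + tribonacci (n + 2) + tribonacci (n + 1).
  by rewrite tribonacci_step; congr (tribonacci _ + tribonacci _ + _); ring.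
by rewrite F4 tribonacci_step F2; ring.
Qed.

Theorem corollary6p3 (n : int) :
  tribonacci n ^+ 2 - tribonacci (n - 1) * tribonacci (n + 1)
    = tribonacci (1 - n).
Proof.
have reflected : (fun m => tribonacci_minor (1 - m)) =1 tribonacci.
  apply: tribonacci_unique => // m.
  rewrite tribonacci_minor_rec.
  by congr (tribonacci_minor _ + tribonacci_minor _ + tribonacci_minor _); ring.
rewrite -(reflected (1 - n)) /=.
by have -> : 1 - (1 - n) = n by ring.
Qed.
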